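(* Let $X$ be a complex Banach space and let $T\colon X\to X$ be a Ritt operator. If $T$ admits a bounded $\mathcal{H}^\infty(B_\gamma)$ functional calculus for some $\gamma\in\bigl(0,\frac{\pi}{2}\bigr)$, then $T$ satisfies the unconditional Ritt condition.
   Context: Let $T\colon X\to X$ be a bounded linear operator on a complex Banach space, with resolvent $R(\lambda,T)=(\lambda-T)^{-1}$. $T$ is a Ritt operator if its spectrum is included in the closed unit disc $\{z\in\mathbb{C}:|z|\le 1\}$ and the set $\{(\lambda-1)R(\lambda,T):|\lambda|>1\}$ is bounded. For $\gamma\in\bigl(0,\frac{\pi}{2}\bigr)$, the Stolz domain $B_\gamma$ is the interior of the convex hull of the point $1$ and the disc $D(0,\sin\gamma)$. $T$ has a bounded $\mathcal{H}^\infty(B_\gamma)$ functional calculus if there is a constant $K\geq 0$ such that $\|P(T)\|\leq K\sup\{|P(z)|:z\in B_\gamma\}$ for every complex polynomial $P$. $T$ satisfies the unconditional Ritt condition if there is a constant $K\geq 0$ such that $\bigl\|\sum_{k\geq 1}a_k(T^k-T^{k-1})\bigr\|\leq K\sup\{|a_k|:k\geq 1\}$ for every finite sequence $(a_k)_{k\geq 1}$ of complex numbers. *)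

(* Defs.v *)
From HB Require Import structures.
From mathcomp Require Import all_boot all_order all_algebra.
From mathcomp Require Import all_classical all_reals all_analysis.
From mathcomp Require Export complex.

Set Implicit Arguments.
Unset Strict Implicit.
Unset Printing Implicit Defensive.

Import Order.TTheory GRing.Theory Num.Theory.
Import numFieldNormedType.Exports.

Local Open Scope classical_set_scope.
Local Open Scope complex_scope.
Local Open Scope ring_scope.

(* Norms over R[i] take values in R[i]; [rnorm v] is the same nonnegative
   number seen in R, where suprema are available. *)
Definition rnorm (R : realType) (V : normedZmodType R[i]) (v : V) : R :=
  complex.Re `|v|.

Section Operators.
Variables (R : realType) (X : completeNormedModType R[i]).

(* [sup] is 0 on sets without an upper bound: [opnorm] is meaningful for
   bounded operators only, and is applied to no others below. *)
Definition opnorm (f : X -> X) : R :=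
  sup [set rnorm (f x) | x in [set x : X | `|x| <= 1]].

(* S = (lam - T)^-1 in the algebra of bounded operators on X *)
Definition is_resolvent (T : {linear X -> X}) (lam : R[i])
    (S : {linear X -> X}) : Prop :=
  [/\ continuous S,
      forall x, S (lam *: x - T x) = x
    & forall x, lam *: S x - T (S x) = x].

Definition spectrum (T : {linear X -> X}) : set R[i] :=
  [set lam | ~ exists S, is_resolvent T lam S].

Definition Ritt (T : {linear X -> X}) : Prop :=
  spectrum T `<=` [set z | `|z| <= 1] /\
  has_ubound [set r : R | exists (lam : R[i]) (S : {linear X -> X}),
    [/\ 1 < `|lam|, is_resolvent T lam S
      & r = opnorm (fun x => (lam - 1) *: S x)]].

Definition poly_op (P : {poly R[i]}) (T : X -> X) (x : X) : X :=
  \sum_(k < size P) P`_k *: iter k T x.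

End Operators.

Definition convex_hull (R : realType) (A : set R[i]^o) : set R[i]^o :=
  smallest (@convex_set R[i] R[i]^o) A.

Definition stolz (R : realType) (gamma : R) : set R[i]^o :=
  interior (convex_hull ([set 1] `|` ball (0 : R[i]^o) (sin gamma)%:C)).

Definition bounded_Hinfty_calculus (R : realType)
    (X : completeNormedModType R[i]) (T : {linear X -> X}) (gamma : R) : Prop :=
  exists2 K : R, 0 <= K & forall P : {poly R[i]},
    opnorm (poly_op P T) <= K * sup [set rnorm P.[z] | z in stolz gamma].

Definition unconditional_Ritt (R : realType)
    (X : completeNormedModType R[i]) (T : {linear X -> X}) : Prop :=
  exists2 K : R, 0 <= K & forall (n : nat) (a : nat -> R[i]),
    opnorm (fun x => \sum_(1 <= k < n.+1) a k *: (iter k T x - iter k.-1 T x))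
      <= K * sup [set rnorm (a k) | k in [set k : nat | (1 <= k <= n)%N]].

(* Main.v *)
Require Import Defs.
From mathcomp Require Import all_boot all_order all_algebra.
From mathcomp Require Import all_classical all_reals all_analysis.
From mathcomp Require Import ring.
Import Order.TTheory GRing.Theory Num.Theory.
Import numFieldNormedType.Exports.
Local Open Scope classical_set_scope.
Local Open Scope ring_scope.

(** For [P(z) = \sum_k a_k (z^k - z^(k-1))] one has
    [|P(z)| <= sup |a_k| * |1 - z| * \sum_k |z|^(k-1)
            <= sup |a_k| * |1 - z| / (1 - |z|)],
    and [|1 - z| / (1 - |z|)] is bounded on a Stolz domain: the inequality
    [|1 - z| + c |z| <= c] defines a convex set, which contains [1] and, for
    [c = (1 + sin gamma) / (1 - sin gamma)], the disc [D(0, sin gamma)]. *)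

(** Both [|1 - z|] and [|z|] are convex in [z], and [0 <= c] makes [|1 - z| + c * |z|] convex too;
    the set is one of its sublevel sets. *)
Lemma convex_set_norm_ratio (K : numFieldType) (c : K) : 0 <= c ->
  @convex_set K K^o [set z : K^o | `|1 - z| <= c * (1 - `|z|)].
Proof.
move=> c0; apply/convex_setW => x y; rewrite !inE /= => hx hy l l0 l1.
rewrite inE /=.
set t := l%:num; have t0 : 0 <= t by exact: ltW.
have t1 : 0 <= 1 - t by rewrite subr_ge0; exact: ltW.
have -> : conv l x y = t * (x : K) + (1 - t) * y :> K by [].
have -> : 1 - (t * (x : K) + (1 - t) * y) = t * (1 - x) + (1 - t) * (1 - y).
  by rewrite !mulrBr !mulr1 opprD addrACA [t + _]addrC subrK.
apply: le_trans (ler_normD _ _) _; rewrite !normrM (ger0_norm t0) (ger0_norm t1).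
apply: le_trans (lerD (ler_wpM2l t0 hx) (ler_wpM2l t1 hy)) _.
have -> : t * (c * (1 - `|x|)) + (1 - t) * (c * (1 - `|y|)) =
    c * (1 - (t * `|x| + (1 - t) * `|y|)).
  rewrite [t * _]mulrCA [(1 - t) * _]mulrCA -mulrDr; congr (_ * _).
  by rewrite !mulrBr !mulr1 addrACA [t + _]addrC subrK opprD.
apply: ler_wpM2l => //; rewrite lerD2l lerN2.
by apply: le_trans (ler_normD _ _) _; rewrite !normrM (ger0_norm t0) (ger0_norm t1).
Qed.

Lemma convex_hull_norm_ratio (R : realType) (r : R) (z : R[i]) : 0 <= r < 1 ->
  convex_hull ([set 1] `|` ball (0 : R[i]^o) r%:C%C) z ->
  `|1 - z| <= ((1 + r) / (1 - r))%:C%C * (1 - `|z|).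
Proof.
move=> /andP[r0 r1]; set c := ((1 + r) / (1 - r))%:C%C.
have c0 : 0 <= c.
  by rewrite /c ler0c divr_ge0 ?subr_ge0 ?(ltW r1)// addr_ge0.
(* The hull is the intersection of all convex sets containing the generators, so only the point [1]
   and the disc remain to be checked. *)
move=> /(_ [set w : R[i]^o | `|1 - w| <= c * (1 - `|w|)]); apply.
split; first exact: convex_set_norm_ratio.
move=> w [->|]; rewrite /= ?subrr ?normr0 ?normr1 ?subrr ?mulr0//.
rewrite -ball_normE /= sub0r normrN => /ltW wr.
(* On the disc [|1 - w| <= 1 + r = c * (1 - r) <= c * (1 - |w|)]; the middle equality dictates the
   value of [c]. *)
apply: le_trans (ler_normB _ _) _; rewrite normr1.
apply: (@le_trans _ _ (1 + r%:C%C)); first by rewrite lerD2l.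
have -> : 1 + r%:C%C = c * (1 - r%:C%C) :> R[i].
  rewrite -(rmorph1 (real_complex R)) -rmorphD -rmorphB -rmorphM /=.
  by rewrite divfK // subr_eq0 gt_eqF.
by rewrite ler_wpM2l// lerD2l lerN2.
Qed.

Lemma norm_sum_powB_le (K : numDomainType) (c M z : K) (a : nat -> K) n :
  0 < c -> 0 <= M -> `|1 - z| <= c * (1 - `|z|) ->
  (forall k, (1 <= k <= n)%N -> `|a k| <= M) ->
  `|\sum_(1 <= k < n.+1) a k * (z ^+ k - z ^+ k.-1)| <= c * M.
Proof.
move=> c0 M0 hz ha.
(* [0 <= |1 - z| <= c * (1 - |z|)] with [c > 0] forces [|z| <= 1]. *)
have z1 : 0 <= 1 - `|z| by rewrite -(pmulr_rge0 _ c0); exact: le_trans hz.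
(* The sharper bound with the factor [1 - |z| ^+ n] is what the induction carries: the term of index
   [k] costs at most [c * M * (|z| ^+ k.-1 - |z| ^+ k)], which telescopes. No division by [1 - |z|]
   occurs, so [z = 1] needs no separate case. *)
apply: (@le_trans _ _ (c * M * (1 - `|z| ^+ n))); last first.
  by rewrite ler_piMr ?mulr_ge0 ?(ltW c0)// gerBl exprn_ge0.
elim: n ha => [|n IH] ha; first by rewrite big_geq// normr0 expr0 subrr mulr0.
rewrite big_nat_recr//=; apply: le_trans (ler_normD _ _) _.
have -> : c * M * (1 - `|z| ^+ n.+1) =
    c * M * (1 - `|z| ^+ n) + M * (`|z| ^+ n * (c * (1 - `|z|))).
  by rewrite exprS; ring.
apply: lerD.
  by apply: IH => k /andP[k1 kn]; apply: ha; rewrite k1 leqW.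
have -> : z ^+ n.+1 - z ^+ n = - (z ^+ n * (1 - z)).
  by rewrite mulrBr mulr1 opprB exprSr.
rewrite mulrN normrN !normrM normrX.
by rewrite ler_pM ?mulr_ge0 ?exprn_ge0// ?ha ?leqnn// ler_wpM2l ?exprn_ge0.
Qed.

(** Coefficients beyond the size vanish. This gives polynomials of different sizes a common
    summation range, whatever cancels in their sum. *)
Lemma poly_op_widen (R : realType) (X : completeNormedModType R[i])
    (P : {poly R[i]}) (T : X -> X) n x : (size P <= n)%N ->
  poly_op P T x = \sum_(k < n) P`_k *: iter k T x.
Proof.
move=> Pn; rewrite /poly_op -!(big_mkord xpredT (fun k => P`_k *: iter k T x)).
rewrite [RHS](big_cat_nat (leq0n _) Pn)//= [X in _ + X]big_nat_cond.
rewrite [X in _ + X]big1 ?addr0//.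
by move=> k /andP[/andP[Pk _] _]; rewrite nth_default// scale0r.
Qed.

Lemma poly_opD (R : realType) (X : completeNormedModType R[i])
    (P Q : {poly R[i]}) (T : X -> X) x :
  poly_op (P + Q) T x = poly_op P T x + poly_op Q T x.
Proof.
set n := maxn (size P) (size Q).
rewrite (@poly_op_widen _ _ (P + Q) _ n) ?size_polyD//.
rewrite (@poly_op_widen _ _ P _ n) ?leq_maxl//.
rewrite (@poly_op_widen _ _ Q _ n) ?leq_maxr// -big_split/=.
by apply: eq_bigr => k _; rewrite coefD scalerDl.
Qed.

Lemma poly_op_diff (R : realType) (X : completeNormedModType R[i])
    (T : X -> X) (c : R[i]) m k x :
  poly_op (c *: ('X^m - 'X^k)) T x = c *: (iter m T x - iter k T x).
Proof.
set n := (maxn m k).+1.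
rewrite (@poly_op_widen _ _ _ _ n); last first.
  apply: leq_trans (size_scale_leq _ _) _; apply: leq_trans (size_polyD _ _) _.
  by rewrite size_polyN !size_polyXn geq_max !ltnS leq_maxl leq_maxr.
have iterE j : (j <= maxn m k)%N ->
    \sum_(i < n) ('X^j : {poly R[i]})`_i *: iter i T x = iter j T x.
  move=> jn; rewrite (bigD1 (Ordinal (jn : (j < n)%N)))//= coefXn eqxx scale1r.
  rewrite big1 ?addr0// => i; rewrite -val_eqE /= => /negbTE ij.
  by rewrite coefXn ij scale0r.
rewrite -(iterE m) ?leq_maxl// -(iterE k) ?leq_maxr//.
rewrite -sumrB scaler_sumr; apply: eq_bigr => i _.
by rewrite coefZ coefB -scalerBl scalerA.
Qed.

Lemma poly_op_sum_diff (R : realType) (X : completeNormedModType R[i])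
    (T : X -> X) (a : nat -> R[i]) n :
  poly_op (\sum_(1 <= k < n.+1) a k *: ('X^k - 'X^(k.-1))) T =
  fun x => \sum_(1 <= k < n.+1) a k *: (iter k T x - iter k.-1 T x).
Proof.
apply/funext => x; elim: n => [|n IH].
  by rewrite !big_geq// /poly_op size_poly0 big_ord0.
by rewrite big_nat_recr//= poly_opD IH poly_op_diff [RHS]big_nat_recr.
Qed.

Lemma sup_ge0 (R : realType) (A : set R) :
  (forall x, A x -> 0 <= x) -> 0 <= sup A.
Proof.
(* When [A] is empty or unbounded, [sup A] takes its default value 0. *)
move=> A0; have [[[x Ax] Aub]|/sup_out ->//] := pselect (has_sup A).
by apply: le_trans (A0 _ Ax) _; exact: ub_le_sup.
Qed.

Lemma rnormE (R : realType) (V : normedZmodType R[i]) (v : V) :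
  (rnorm v)%:C%C = `|v|.
Proof. by rewrite RRe_real ?normr_real. Qed.

Lemma rnorm_ge0 (R : realType) (V : normedZmodType R[i]) (v : V) :
  0 <= rnorm v.
Proof. by rewrite -ler0c rnormE. Qed.

Lemma rnorm_le_sup (R : realType) (a : nat -> R[i]) n k : (1 <= k <= n)%N ->
  rnorm (a k) <= sup [set rnorm (a k) | k in [set k | (1 <= k <= n)%N]].
Proof.
move=> kn; apply: ub_le_sup; last by exists k.
(* The sum of all the norms is a crude upper bound of this finite set. *)
exists (\sum_(1 <= i < n.+1) rnorm (a i)) => _ [j /= jn <-].
rewrite (bigD1_seq j) ?iota_uniq ?mem_index_iota//=.
by rewrite lerDl sumr_ge0// => i _; exact: rnorm_ge0.
Qed.

Theorem lemma4p1 (R : realType) (X : completeNormedModType R[i])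
    (T : {linear X -> X}) (Tbounded : continuous T) (TRitt : Ritt T)
    (Tcalculus : exists gamma : R,
      0 < gamma < pi / 2 /\ bounded_Hinfty_calculus T gamma) :
  unconditional_Ritt T.
Proof.
have [gamma [/andP[g0 g2] [K K0 calc]]] := Tcalculus.
set s := sin gamma.
have s0 : 0 <= s.
  rewrite sin_ge0_pi// (ltW g0)/= (le_trans (ltW g2))//.
  by rewrite ler_pdivrMr// ler_peMr ?pi_ge0// ler1n.
have s1 : s < 1.
  have pi2 : - (pi / 2) <= 0 :> R by rewrite oppr_le0 divr_ge0 ?pi_ge0.
  rewrite -(@sin_pihalf R) ltr_sin// in_itv/= ?lexx ?andbT.
    by rewrite (ltW g2) andbT (le_trans pi2)// ltW.
  by rewrite (le_trans pi2)// divr_ge0 ?pi_ge0.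
set c := (1 + s) / (1 - s).
have c0 : 0 < c by rewrite divr_gt0 ?subr_gt0// ltr_wpDr.
(* [K] is the constant of the functional calculus; [c] bounds [|1 - z| / (1 - |z|)] on the Stolz
   domain. *)
exists (K * c) => [|n a]; first by rewrite mulr_ge0// ltW.
set M := sup _.
have aM k : (1 <= k <= n)%N -> `|a k| <= M%:C%C.
  by move=> kn; rewrite -rnormE lecR rnorm_le_sup.
(* This includes [n = 0], where [M] is the supremum of the empty set. *)
have M0 : 0 <= M.
  by apply: sup_ge0 => _ [k _ <-]; exact: rnorm_ge0.
rewrite -poly_op_sum_diff; apply: le_trans (calc _) _.
rewrite -mulrA ler_wpM2l//.
set S := [set _ | _ in _].
(* Bounding a supremum by [ge_sup] requires a nonempty set; for an empty one the default
   [sup set0 = 0] suffices. *)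
have [->|/set0P S0] := eqVneq S set0; first by rewrite sup0 mulr_ge0// ltW.
apply: ge_sup => // _ [z hz <-].
rewrite -lecR rnormE rmorphM /= horner_sum.
under eq_bigr do rewrite hornerZ hornerD hornerN !hornerXn.
apply: norm_sum_powB_le => //; rewrite ?lecR//; first by rewrite ltcR.
apply: convex_hull_norm_ratio; first by rewrite s0 s1.
exact: interior_subset hz.
Qed.
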